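(* Let $X$ be a finite multigraph with $\chi(X)\neq 0$, let $\ell$ be an odd prime, let $S$ be the image of a section $\gamma:E_X\to E_X^+$ of the quotient map $\pi:E_X^+\to E_X$, and let $\alpha:S\to\mathbb{Z}_\ell$ be a function such that the derived multigraphs $X(\mathbb{Z}/\ell^n\mathbb{Z},S,\alpha_{/n})$ are connected for all $n\geq 0$. Then $\lambda_\ell(X,\alpha)$ is odd.
   Context: A finite multigraph $X$ consists of a finite set of vertices $V_X=\{v_1,\dots,v_u\}$, a finite set of directed edges $E_X^+$, an incidence function $i:E_X^+\to V_X\times V_X$, $i(e)=(o(e),t(e))$ (origin and target), and an inversion function $\iota:E_X^+\to E_X^+$, $\iota(e)=\bar e$, such that $\iota^2=\mathrm{id}$, $\iota(e)\ne e$ and $i(\bar e)=(t(e),o(e))$ for all $e$. Loops and multiple edges are allowed. The set of undirected edges is $E_X=E_X^+/\iota$, $\pi:E_X^+\to E_X$ is the quotient map, and $\chi(X)=|V_X|-|E_X|$. Derived multigraph: let $G$ be a finite abelian group (written additively) and $\beta:S\to G$ a function, extended to $E_X^+$ by $\beta(\bar s)=-\beta(s)$. The multigraph $X(G,S,\beta)$ has vertex set $V_X\times G$ and directed edge set $E_X^+\times G$; the directed edge $(e,\sigma)$ goes from $(o(e),\sigma)$ to $(t(e),\sigma+\beta(e))$, and $\overline{(e,\sigma)}=(\bar e,\sigma+\beta(e))$. For $\alpha:S\to\mathbb{Z}_\ell$, $\alpha_{/n}$ is its reduction modulo $\ell^n$. Characteristic series: for $b\in\mathbb{Z}_\ell$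 put $\binom{b}{n}=\frac{b(b-1)\cdots(b-n+1)}{n!}\in\mathbb{Z}_\ell$ and $(1+T)^b=\sum_{n\ge0}\binom{b}{n}T^n\in\mathbb{Z}_\ell[[T]]$. Let $D$ be the $u\times u$ diagonal matrix whose $i$-th diagonal entry is the valency $\#\{e\in E_X^+: o(e)=v_i\}$. Let $M(1+T)$ be the $u\times u$ matrix over $\mathbb{Z}_\ell[[T]]$ $$M(1+T)=D-\Big(\sum_{s\in S,\ i(s)=(v_i,v_j)}(1+T)^{\alpha(s)}+\sum_{s\in S,\ i(s)=(v_j,v_i)}(1+T)^{-\alpha(s)}\Big)_{i,j}$$ and $f(T)=\det M(1+T)$. Under the stated hypotheses $f(T)\ne0$, and its constant term is always $0$. By the Weierstrass preparation theorem write $f(T)=\ell^{\mu}g(T)u(T)$ with $\mu\in\mathbb{Z}_{\ge0}$, $g(T)$ a distinguished polynomial (monic with all non-leading coefficients divisible by $\ell$) and $u(T)\in\mathbb{Z}_\ell[[T]]^\times$. Then $\mu_\ell(X,\alpha):=\mu$ and $\lambda_\ell(X,\alpha):=\deg g(T)-1$ (note the shift by $-1$). *)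

(* Defs.v *)
From HB Require Import structures.
From mathcomp Require Import all_boot all_order all_algebra.
From mathcomp Require Import boolp classical_sets.

Set Implicit Arguments.
Unset Strict Implicit.
Unset Printing Implicit Defensive.

Import Order.TTheory GRing.Theory Num.Theory.
Local Open Scope ring_scope.

Record multigraph := Multigraph {
  vertex : finType;
  dedge : finType;
  incid : dedge -> vertex * vertex;
  einv : dedge -> dedge;
  einvK : involutive einv;
  einv_neq : forall e, einv e != e;
  incid_einv : forall e, incid (einv e) = ((incid e).2, (incid e).1)
}.

Definition origin (X : multigraph) (e : dedge X) : vertex X := (incid e).1.
Definition target (X : multigraph) (e : dedge X) : vertex X := (incid e).2.

Definition uedge_set (X : multigraph) : {set {set dedge X}} :=
  [set [set e; einv e] | e in [set: dedge X]].

(* The quotient of the directed edges by inversion, as the type of orbits. *)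
Definition uedge (X : multigraph) : finType :=
  {B : {set dedge X} | B \in uedge_set X}.

Lemma uedge_proof (X : multigraph) (e : dedge X) :
  [set e; einv e] \in uedge_set X.
Proof. by apply/imsetP; exists e. Qed.

Definition uedge_pi (X : multigraph) (e : dedge X) : uedge X :=
  exist (fun B => B \in uedge_set X) _ (uedge_proof e).

Definition euler_char (X : multigraph) : int :=
  #|vertex X|%:Z - #|uedge X|%:Z.

Definition valency (X : multigraph) (v : vertex X) : nat :=
  #|[set e : dedge X | origin e == v]|.

Definition adjacent (X : multigraph) : rel (vertex X) :=
  fun v w => [exists e : dedge X, incid e == (v, w)].

Definition connected (X : multigraph) : Prop :=
  forall v w : vertex X, connect (@adjacent X) v w.

Definition section_image (X : multigraph) (gamma : uedge X -> dedge X) :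
  {set dedge X} := [set gamma x | x in [set: uedge X]].

Definition section_edge (X : multigraph) (gamma : uedge X -> dedge X) : finType :=
  {s : dedge X | s \in section_image gamma}.

(* When gamma is a section, exactly one of e and einv e lies in its image, so the
   last branch is never reached and the result is antisymmetric; see
   [section_dichotomy] and [extend_einv]. *)
Definition extend (X : multigraph) (gamma : uedge X -> dedge X) (G : zmodType)
    (beta : section_edge gamma -> G) (e : dedge X) : G :=
  if insub e is Some s then beta s
  else if insub (einv e) is Some s then - beta s else 0.

Section Section.
Variables (X : multigraph) (gamma : uedge X -> dedge X).
Hypothesis gammaK : cancel gamma (@uedge_pi X).

Lemma uedge_pi_einv (e : dedge X) : uedge_pi (einv e) = uedge_pi e.
Proof. by apply: val_inj; rewrite /= einvK finset.setUC. Qed.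

Lemma section_dichotomy (e : dedge X) :
  (einv e \in section_image gamma) = (e \notin section_image gamma).
Proof.
have gpi (a : dedge X) : (a \in section_image gamma) = (gamma (uedge_pi a) == a).
  apply/imsetP/eqP => [[x _ ->]|<-]; first by rewrite gammaK.
  by exists (uedge_pi a); rewrite ?inE ?gammaK.
rewrite !gpi uedge_pi_einv; set c := gamma _.
have : c \in [set e; einv e].
  have /(congr1 val) /= := gammaK (uedge_pi e); rewrite -/c => <-.
  by rewrite !inE eqxx.
rewrite !inE; case: eqP => [-> _|_ /= -> //].
by rewrite eq_sym (negPf (einv_neq e)).
Qed.

Lemma extend_einv (G : zmodType) (beta : section_edge gamma -> G) (e : dedge X) :
  extend beta (einv e) = - extend beta e.
Proof.
have := section_dichotomy e; rewrite /extend einvK.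
case: (insubP _ e) => [s eS _|/negPf eS]; case: (insubP _ (einv e)) => [s' -> _|/negPf -> ].
- by rewrite eS.
- by [].
- by rewrite opprK.
- by rewrite eS.
Qed.

Variables (G : finZmodType) (beta : section_edge gamma -> G).

Definition derived_incid (a : dedge X * G) :
    (vertex X * G) * (vertex X * G) :=
  ((origin a.1, a.2), (target a.1, a.2 + extend beta a.1)).

Definition derived_einv (a : dedge X * G) : dedge X * G :=
  (einv a.1, a.2 + extend beta a.1).

Lemma derived_einvK : involutive derived_einv.
Proof. by case=> e g; rewrite /derived_einv /= einvK extend_einv addrK. Qed.

Lemma derived_einv_neq a : derived_einv a != a.
Proof.
by case: a => e g; apply/negP => /eqP [he _]; have := einv_neq e; rewrite he eqxx.
Qed.

Lemma derived_incid_einv a :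
  derived_incid (derived_einv a) = ((derived_incid a).2, (derived_incid a).1).
Proof.
case: a => e g.
by rewrite /derived_incid /derived_einv /origin /target /= incid_einv
  extend_einv addrK.
Qed.

Definition derived : multigraph := {|
  vertex := (vertex X * G)%type;
  dedge := (dedge X * G)%type;
  incid := derived_incid;
  einv := derived_einv;
  einvK := derived_einvK;
  einv_neq := derived_einv_neq;
  incid_einv := derived_incid_einv |}.

End Section.

(* Z/mZ for m > 0, including the trivial group for m = 1 ('Z_1 would be Z/2). *)
Definition Zmod (m : nat) : finZmodType := 'I_(m.-1.+1).

Lemma Zmod_redD m n (x y : nat) : (m.-1.+1 %| n.-1.+1)%N ->
  (inZp (((x + y) %% n.-1.+1)%N) : Zmod m) = inZp x + inZp y.
Proof. by move=> mn; apply: val_inj; rewrite /= modn_dvdm // modnDm. Qed.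

(* The inverse limit of the Z/l^n, n >= 0. The primality proof is a parameter
   so that the type carries its nonzero commutative ring structure. *)
Record padic (l : nat) (l_prime : prime l) := Padic {
  padic_red : forall n, Zmod (l ^ n);
  padic_compat : forall n, padic_red n = inZp (val (padic_red n.+1))
}.
Arguments padic_red {l l_prime} x n : rename.

Section PadicRing.
Variables (l : nat) (l_prime : prime l).
Local Notation Zl := (padic l_prime).
Implicit Types x y z : Zl.

HB.instance Definition _ := gen_eqMixin Zl.
HB.instance Definition _ := gen_choiceMixin Zl.

Lemma padicP x y : (forall n, padic_red x n = padic_red y n) -> x = y.
Proof.
case: x y => [x xP] [y yP] /= exy.
have {}exy : x = y by apply: functional_extensionality_dep.
by rewrite exy in xP *; congr Padic; apply: Prop_irrelevance.
Qed.

Let lP n : (l ^ n).-1.+1 = (l ^ n)%N.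
Proof. by rewrite prednK // expn_gt0 prime_gt0. Qed.

Let ldvd n : ((l ^ n).-1.+1 %| (l ^ n.+1).-1.+1)%N.
Proof. by rewrite !lP expnS dvdn_mull. Qed.

Fact padic_zero_subproof n : (0 : Zmod (l ^ n)) = inZp (val (0 : Zmod (l ^ n.+1))).
Proof. by apply: val_inj. Qed.
Definition padic_zero : Zl := Padic l_prime padic_zero_subproof.

Fact padic_one_subproof n :
  (inZp 1 : Zmod (l ^ n)) = inZp (val (inZp 1 : Zmod (l ^ n.+1))).
Proof. by apply: val_inj; rewrite /= modn_dvdm. Qed.
Definition padic_one : Zl := Padic l_prime padic_one_subproof.

Fact padic_add_subproof x y n :
  (padic_red x n + padic_red y n : Zmod (l ^ n)) =
  inZp (val (padic_red x n.+1 + padic_red y n.+1)).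
Proof.
rewrite (padic_compat x) (padic_compat y); apply: val_inj => /=.
by rewrite modn_dvdm // modnDm.
Qed.
Definition padic_add x y : Zl := Padic l_prime (padic_add_subproof x y).

Fact padic_opp_subproof x n :
  (- padic_red x n : Zmod (l ^ n)) = inZp (val (- padic_red x n.+1)).
Proof.
apply: (addrI (padic_red x n)); rewrite addrN {1}(padic_compat x).
rewrite -(@Zmod_redD _ (l ^ n.+1)) //.
rewrite -[X in inZp X]/(val (padic_red x n.+1 - padic_red x n.+1)) addrN.
exact: val_inj.
Qed.
Definition padic_opp x : Zl := Padic l_prime (padic_opp_subproof x).

Fact padic_mul_subproof x y n :
  (Zp_mul (padic_red x n) (padic_red y n) : Zmod (l ^ n)) =
  inZp (val (Zp_mul (padic_red x n.+1) (padic_red y n.+1))).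
Proof.
rewrite (padic_compat x) (padic_compat y); apply: val_inj => /=.
by rewrite modn_dvdm // modnMm.
Qed.
Definition padic_mul x y : Zl := Padic l_prime (padic_mul_subproof x y).

Fact padic_addA : associative padic_add.
Proof. by move=> x y z; apply: padicP => n; apply: addrA. Qed.
Fact padic_addC : commutative padic_add.
Proof. by move=> x y; apply: padicP => n; apply: addrC. Qed.
Fact padic_add0 : left_id padic_zero padic_add.
Proof. by move=> x; apply: padicP => n; apply: add0r. Qed.
Fact padic_addN : left_inverse padic_zero padic_opp padic_add.
Proof. by move=> x; apply: padicP => n; apply: addNr. Qed.
HB.instance Definition _ :=
  GRing.isZmodule.Build Zl padic_addA padic_addC padic_add0 padic_addN.

Fact padic_mulA : associative padic_mul.
Proof. by move=> x y z; apply: padicP => n; apply: Zp_mulA. Qed.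
Fact padic_mulC : commutative padic_mul.
Proof. by move=> x y; apply: padicP => n; apply: Zp_mulC. Qed.
Fact padic_mul1 : left_id padic_one padic_mul.
Proof. by move=> x; apply: padicP => n; apply: Zp_mul1z. Qed.
Fact padic_mulDl : left_distributive padic_mul padic_add.
Proof. by move=> x y z; apply: padicP => n; apply: Zp_mul_addl. Qed.
Fact padic_one_neq0 : padic_one != 0.
Proof.
apply/eqP => /(congr1 (fun x => val (padic_red x 1))) /=.
by rewrite lP expn1 modn_small // prime_gt1.
Qed.
HB.instance Definition _ :=
  GRing.Zmodule_isComNzRing.Build Zl padic_mulA padic_mulC padic_mul1
    padic_mulDl padic_one_neq0.

(* binom(b, n) is the c such that n! c = b (b - 1) ... (b - n + 1); existence
   and uniqueness are [fact_padic_binom] and [fact_mulI] below. *)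
Definition padic_binom (b : Zl) (n : nat) : Zl :=
  xget 0 [set c | n`!%:R * c = \prod_(i < n) (b - i%:R)]%classic.

Lemma padic_natE m k : padic_red (m%:R : Zl) k = inZp m.
Proof.
elim: m => [|m IHm]; first by apply: val_inj; rewrite /= mod0n.
rewrite mulrSr -[LHS]/(padic_red (m%:R : Zl) k + inZp 1) IHm.
by apply: val_inj; rewrite /= modnDm addn1.
Qed.

Lemma padic_red_eq x y k : (padic_red (x - y) k = 0) <-> padic_red x k = padic_red y k.
Proof.
rewrite -[padic_red (x - y) k]/(padic_red x k - padic_red y k).
by split=> [/eqP|->]; rewrite ?subrr // subr_eq0 => /eqP.
Qed.

Lemma padic_redM x y x' y' k : padic_red x k = padic_red x' k ->
  padic_red y k = padic_red y' k -> padic_red (x * y) k = padic_red (x' * y') k.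
Proof.
move=> ex ey.
by rewrite -[LHS]/(Zp_mul (padic_red x k) (padic_red y k)) ex ey.
Qed.

Lemma padic_redB x y x' y' k : padic_red x k = padic_red x' k ->
  padic_red y k = padic_red y' k -> padic_red (x - y) k = padic_red (x' - y') k.
Proof.
move=> ex ey.
by rewrite -[LHS]/(padic_red x k - padic_red y k) ex ey.
Qed.

Lemma natr_ffact (R : comNzRingType) m n :
  \prod_(i < n) (m%:R - i%:R) = (m ^_ n)%:R :> R.
Proof.
elim: n => [|n IHn]; first by rewrite big_ord0 ffactn0.
rewrite big_ord_recr /= IHn ffactnSr natrM.
have [nm|mn] := leqP n m; first by rewrite natrB.
by rewrite ffact_small // !mul0r.
Qed.

Lemma inZp_eq k a b :
  (inZp a = inZp b :> Zmod (l ^ k)) <-> a = b %[mod l ^ k].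
Proof.
rewrite -(lP k); split=> [/(congr1 val) //|ab]; exact: val_inj.
Qed.

Lemma padic_red_add x k j : padic_red x k = inZp (val (padic_red x (k + j))).
Proof.
elim: j => [|j IHj]; first by rewrite addn0 valZpK.
rewrite addnS IHj padic_compat; apply: val_inj; rewrite /= modn_dvdm // !lP.
by rewrite dvdn_exp2l // leq_addr.
Qed.

Lemma fact_cancel n k a b : (0 < n)%N ->
  n * a = n * b %[mod l ^ (k + logn l n)] -> a = b %[mod l ^ k].
Proof.
move=> n0; wlog ab : a b / (b <= a)%N => [hw|].
  by have [/hw//|/ltnW/hw h /esym/h] := leqP b a.
move=> /eqP; rewrite eqn_mod_dvd ?leq_mul2l ?ab ?orbT // -mulnBr => h.
apply/eqP; rewrite eqn_mod_dvd //.
have [->|c0] := posnP (a - b); first exact: dvdn0.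
move: h; rewrite !pfactor_dvdn ?muln_gt0 ?n0 //.
by rewrite lognM // addnC leq_add2l.
Qed.

Lemma fact_padic_binom b n :
  n`!%:R * padic_binom b n = \prod_(i < n) (b - i%:R).
Proof.
rewrite /padic_binom; case: xgetP => [c _ -> //|] /= hn; exfalso.
set N := logn l n`!.
have cP k : (inZp 'C(val (padic_red b (k + N)), n) : Zmod (l ^ k)) =
    inZp (val (inZp 'C(val (padic_red b (k.+1 + N)), n) : Zmod (l ^ k.+1))).
  suff h : 'C(val (padic_red b (k + N)), n) =
           'C(val (padic_red b (k.+1 + N)), n) %[mod l ^ k].
    by rewrite -(lP k) in h; apply: val_inj; rewrite /= modn_dvdm.
  apply: (@fact_cancel n`!); first exact: fact_gt0.
  rewrite -/N ![(n`! * _)%N]mulnC !bin_ffact.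
  have e : padic_red b (k + N) = inZp (val (padic_red b (k.+1 + N))).
    by rewrite addSn -padic_compat.
  have : padic_red ((val (padic_red b (k + N)))%:R : Zl) (k + N) =
         padic_red ((val (padic_red b (k.+1 + N)))%:R : Zl) (k + N).
    by rewrite !padic_natE valZpK.
  move: (val _) (val _) => u v euv.
  suff : padic_red ((u ^_ n)%:R : Zl) (k + N) = padic_red ((v ^_ n)%:R : Zl) (k + N).
    by rewrite !padic_natE => /(congr1 val) /=; rewrite !lP.
  rewrite -!natr_ffact; elim/big_ind2: _ => // [|i _]; first by move=> *; apply: padic_redM.
  exact: padic_redB.
apply: (hn (Padic l_prime cP)); apply: padicP => k.
set u := val (padic_red b (k + N)).
have -> : padic_red (\prod_(i < n) (b - i%:R)) k =
          padic_red (\prod_(i < n) (u%:R - i%:R) : Zl) k.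
  elim/big_ind2: _ => // [|i _]; first by move=> *; apply: padic_redM.
  by apply: padic_redB => //; rewrite padic_natE (padic_red_add b k N).
rewrite natr_ffact -bin_ffact mulnC natrM; apply: padic_redM => //=.
by rewrite padic_natE.
Qed.

Lemma fact_mulI n : injective (fun c : Zl => n`!%:R * c).
Proof.
move=> c d /= e; apply: padicP => k; set N := logn l n`!.
rewrite !(padic_red_add _ k N); apply/inZp_eq.
apply: (@fact_cancel n`!); first exact: fact_gt0.
apply/inZp_eq; have := congr1 (fun x => padic_red x (k + N)) e => /=.
by rewrite !padic_natE => /(congr1 val) /=; rewrite !modnMml => h; apply: val_inj.
Qed.

End PadicRing.

Record fps (R : comNzRingType) := Fps { fps_coef : nat -> R }.

Section FpsRing.
Variable R : comNzRingType.
Implicit Types f g h : fps R.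

HB.instance Definition _ := gen_eqMixin (fps R).
HB.instance Definition _ := gen_choiceMixin (fps R).

Lemma fpsP f g : fps_coef f =1 fps_coef g -> f = g.
Proof. by case: f g => [f] [g] /= /funext ->. Qed.

Definition fps_of_poly (p : {poly R}) : fps R := Fps (fun n => p`_n).

Definition fps_add f g : fps R := Fps (fun n => fps_coef f n + fps_coef g n).
Definition fps_opp f : fps R := Fps (fun n => - fps_coef f n).
Definition fps_mul f g : fps R :=
  Fps (fun n => \sum_(i < n.+1) fps_coef f i * fps_coef g (n - i)).

Fact fps_addA : associative fps_add.
Proof. by move=> f g h; apply: fpsP => n; apply: addrA. Qed.
Fact fps_addC : commutative fps_add.
Proof. by move=> f g; apply: fpsP => n; apply: addrC. Qed.
Fact fps_add0 : left_id (fps_of_poly 0) fps_add.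
Proof. by move=> f; apply: fpsP => n; rewrite /= coef0 add0r. Qed.
Fact fps_addN : left_inverse (fps_of_poly 0) fps_opp fps_add.
Proof. by move=> f; apply: fpsP => n; rewrite /= coef0 addNr. Qed.
HB.instance Definition _ :=
  GRing.isZmodule.Build (fps R) fps_addA fps_addC fps_add0 fps_addN.

Let tr n f : {poly R} := \poly_(i < n.+1) fps_coef f i.

Let trE n f i : (i <= n)%N -> (tr n f)`_i = fps_coef f i.
Proof. by move=> lein; rewrite coef_poly ltnS lein. Qed.

Let fps_mulE n f g i : (i <= n)%N -> fps_coef (fps_mul f g) i = (tr n f * tr n g)`_i.
Proof.
move=> lein; rewrite coefM /=; apply: eq_bigr => j _.
have ji : (j <= i)%N by rewrite -ltnS.
by rewrite !trE // (leq_trans _ lein) // leq_subr.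
Qed.

Fact fps_mulC : commutative fps_mul.
Proof. by move=> f g; apply: fpsP => n; rewrite !(@fps_mulE n) // mulrC. Qed.

Fact fps_mulA : associative fps_mul.
Proof.
move=> f g h; apply: fpsP => n.
have E f1 f2 f3 : fps_coef (fps_mul (fps_mul f1 f2) f3) n =
    (tr n f1 * tr n f2 * tr n f3)`_n.
  rewrite coefM; apply: eq_bigr => j _.
  have jn : (j <= n)%N by rewrite -ltnS.
  by rewrite (@fps_mulE n) // trE // leq_subr.
by rewrite fps_mulC !E mulrC mulrA.
Qed.

Fact fps_mul1 : left_id (fps_of_poly 1) fps_mul.
Proof.
move=> f; apply: fpsP => n /=; rewrite big_ord_recl /= coef1 mul1r subn0.
by rewrite big1 ?addr0 // => i _; rewrite coef1 mul0r.
Qed.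

Fact fps_mulDl : left_distributive fps_mul fps_add.
Proof.
move=> f g h; apply: fpsP => n /=; rewrite -big_split /=.
by apply: eq_bigr => i _; rewrite mulrDl.
Qed.

Fact fps_one_neq0 : fps_of_poly 1 != 0.
Proof.
apply/eqP => /(congr1 (fun f => fps_coef f 0)) /= /eqP.
by rewrite coef1 coef0 oner_eq0.
Qed.

HB.instance Definition _ :=
  GRing.Zmodule_isComNzRing.Build (fps R) fps_mulA fps_mulC fps_mul1
    fps_mulDl fps_one_neq0.

Definition fps_unit : {pred fps R} := fun f => `[< exists g, g * f = 1 >].
Definition fps_inv f : fps R :=
  if fps_unit f then xget 0 [set g | g * f = 1]%classic else f.

Fact fps_mulVf : {in fps_unit, left_inverse 1 fps_inv *%R}.
Proof.
move=> f uf; rewrite /fps_inv (uf : fps_unit f).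
case: xgetP => [g _ //|hn]; have /asboolP [g gf] := uf.
by case: (hn g).
Qed.

Fact fps_unitPl f g : g * f = 1 -> fps_unit f.
Proof. by move=> gf; apply/asboolP; exists g. Qed.

Fact fps_inv_out : {in [predC fps_unit], fps_inv =1 id}.
Proof. by move=> f; rewrite inE /fps_inv => /negPf h; rewrite [fps_unit f]h. Qed.

HB.instance Definition _ :=
  GRing.ComNzRing_hasMulInverse.Build (fps R) fps_mulVf fps_unitPl fps_inv_out.

End FpsRing.

Section Iwasawa.
Variables (l : nat) (l_prime : prime l).
Local Notation Zl := (padic l_prime).

Definition onePlusT_pow (b : Zl) : fps Zl := Fps (padic_binom b).

Definition distinguished (g : {poly Zl}) : Prop :=
  g \is monic /\
  forall i, (i < (size g).-1)%N -> exists c : Zl, g`_i = l%:R * c.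

Definition weierstrass_factorization
    (f : fps Zl) (mu : nat) (g : {poly Zl}) (u : fps Zl) : Prop :=
  [/\ distinguished g, u \is a GRing.unit
    & f = l%:R ^+ mu * fps_of_poly g * u].

(* By the Weierstrass preparation theorem, a nonzero f has a factorization, and
   mu and g are unique; the junk value 0 is returned only for f = 0. *)
Definition lambda_invariant (f : fps Zl) : int :=
  xget 0 [set lam | exists mu g u,
    weierstrass_factorization f mu g u /\ lam = (size g).-1%:Z - 1]%classic.

Variables (X : multigraph) (gamma : uedge X -> dedge X).
Variable alpha : section_edge gamma -> Zl.

Definition char_matrix : 'M[fps Zl]_#|vertex X| :=
  diag_mx (\row_i (valency (enum_val i))%:R) -
  \matrix_(i, j)
    (\sum_(s : section_edge gamma | incid (val s) == (enum_val i, enum_val j))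
       onePlusT_pow (alpha s) +
     \sum_(s : section_edge gamma | incid (val s) == (enum_val j, enum_val i))
       onePlusT_pow (- alpha s)).

Definition char_series : fps Zl := \det char_matrix.

Definition lambda_voltage : int := lambda_invariant char_series.

End Iwasawa.

(* Main.v *)
Require Import Defs.
From HB Require Import structures.
From mathcomp Require Import all_boot all_order all_algebra all_field.
From mathcomp Require Import boolp classical_sets.
From mathcomp Require Import ring zify.
Set Implicit Arguments.
Unset Strict Implicit.
Unset Printing Implicit Defensive.
Import Order.TTheory GRing.Theory Num.Theory.
Local Open Scope ring_scope.

(** The substitution [1 + T -> 1 / (1 + T)], that is [T -> - T / (1 + T)], transposes
    [M(1 + T)], so it fixes [f = det M(1 + T)].  If [f = l^mu g u], the lowest term of
    [f / l^mu] modulo [l] is [c T^d] with [d = deg g] and [c <> 0], and the substitution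
    multiplies it by [(-1)^d]; as [l] is odd, [d] is even.  To avoid substituting power
    series, [f] is approximated modulo [(l^N, T^L)] by [F(1 + T)], where [F] is the
    integer polynomial obtained by replacing [alpha] by natural numbers [a] and
    [- alpha] by [l^K - a] with [a = alpha] modulo [l^K].

    It remains to see that [f <> 0], so that the Weierstrass factorization exists.  For a
    primitive [l]-th root of unity [z], [F(z)] does not depend on [K], and [f = 0] would
    make it divisible by every power of [l] in the algebraic integers, hence zero.  But
    [M(z)] is Hermitian and
    [v M(z) v^* = \sum_s |v_(t s) - z^(alpha s) v_(o s)|^2], so a kernel vector [v] gives
    the function [(x, a) |-> v_x z^(- a)] on the derived multigraph over [Z/l], which is
    constant on edges; by connectedness [v = 0]. *)

(** * Formal power series *)

Section Fps.
Variable R : comNzRingType.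
Implicit Types f g : fps R.

Lemma fps_coefD f g i : fps_coef (f + g) i = fps_coef f i + fps_coef g i.
Proof. by []. Qed.

Lemma fps_coefN f i : fps_coef (- f) i = - fps_coef f i.
Proof. by []. Qed.

Lemma fps_coefB f g i : fps_coef (f - g) i = fps_coef f i - fps_coef g i.
Proof. by []. Qed.

Lemma fps_coefM f g n :
  fps_coef (f * g) n = \sum_(i < n.+1) fps_coef f i * fps_coef g (n - i).
Proof. by []. Qed.

Lemma fps_coef0 i : fps_coef (0 : fps R) i = 0.
Proof. exact: coef0. Qed.

Lemma fps_coef1 i : fps_coef (1 : fps R) i = (i == 0%N)%:R.
Proof. exact: coef1. Qed.

Lemma fps_coef_natM n f i : fps_coef (n%:R * f) i = n%:R * fps_coef f i.
Proof.
rewrite !mulr_natl; elim: n => [|n IHn]; first by rewrite !mulr0n fps_coef0.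
by rewrite !mulrS fps_coefD IHn.
Qed.

Fact fps_of_poly_is_zmod_morphism : zmod_morphism (@fps_of_poly R).
Proof. by move=> p q; apply: fpsP => i; rewrite /= coefB. Qed.

Fact fps_of_poly_is_monoid_morphism : monoid_morphism (@fps_of_poly R).
Proof. by split=> // p q; apply: fpsP => i; rewrite /= coefM. Qed.

HB.instance Definition _ :=
  GRing.isZmodMorphism.Build {poly R} (fps R) (@fps_of_poly R)
    fps_of_poly_is_zmod_morphism.
HB.instance Definition _ :=
  GRing.isMonoidMorphism.Build {poly R} (fps R) (@fps_of_poly R)
    fps_of_poly_is_monoid_morphism.

Lemma fps_coefXnM n f i :
  fps_coef (fps_of_poly 'X^n * f) i = if (i < n)%N then 0 else fps_coef f (i - n).
Proof.
have [lt_in|le_ni] := ltnP.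
  rewrite fps_coefM big1 // => j _; rewrite /= coefXn.
  by rewrite ltn_eqF ?mul0r // (leq_ltn_trans _ lt_in) // -ltnS.
have lt_n : (n < i.+1)%N by [].
rewrite fps_coefM (bigD1 (Ordinal lt_n)) //= coefXn eqxx mul1r big1 ?addr0 //.
by move=> j jn; rewrite coefXn [nat_of_ord j == n](negPf jn) mul0r.
Qed.

(* Geometric series: with [w = 1 - c f], the [n]-th coefficient of [1 / (1 - w)] is
   already that of the partial sum up to [w ^+ n]. *)
Lemma fps_unit_coef0 f : (exists c, c * fps_coef f 0%N = 1) -> f \is a GRing.unit.
Proof.
case=> c cf; set w := 1 - fps_of_poly c%:P * f.
have w0 : fps_coef w 0%N = 0.
  by rewrite fps_coefB fps_coef1 fps_coefM big_ord1 /= coefC eqxx cf subrr.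
have wX k i : (i < k)%N -> fps_coef (w ^+ k) i = 0.
  elim: k i => // k IHk i ik; rewrite exprS fps_coefM big1 // => j _.
  case: (posnP j) => [->|j0]; first by rewrite w0 mul0r.
  by rewrite IHk ?mulr0 //; move: (nat_of_ord j) j0 (ltn_ord j) => m /=; lia.
pose s n := \sum_(k < n) w ^+ k.
have sE n : (1 - w) * s n = 1 - w ^+ n.
  by rewrite -opprB mulNr -subrX1 opprB.
have sS n m : (n < m)%N -> fps_coef (s m) n = fps_coef (s n.+1) n.
  elim: m => // m IHm; rewrite ltnS leq_eqVlt => /orP[/eqP -> //|nm].
  by rewrite /s big_ord_recr fps_coefD wX // addr0 IHm.
pose z := Fps (fun n => fps_coef (s n.+1) n).
have zE : (1 - w) * z = 1.
  apply: fpsP => n; transitivity (fps_coef ((1 - w) * s n.+1) n).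
    rewrite !fps_coefM; apply: eq_bigr => i _; congr (_ * _).
    by rewrite /= [RHS]sS // ltnS leq_subr.
  by rewrite sE fps_coefB wX // subr0.
apply/asboolP; exists (z * fps_of_poly c%:P).
by rewrite -mulrA -zE mulrC /w opprB addrC subrK.
Qed.

Definition fps_shift n f : fps R := Fps (fun i => fps_coef f (i + n)).

Lemma fps_coef_shift n f i : fps_coef (fps_shift n f) i = fps_coef f (i + n).
Proof. by []. Qed.

End Fps.

(** * Congruences in the l-adic integers *)

Section Padic.
Variables (l : nat) (l_prime : prime l).
Local Notation Zl := (padic l_prime).
Implicit Types x y : Zl.

Lemma predn_expK n : (l ^ n).-1.+1 = (l ^ n)%N.
Proof. by rewrite prednK // expn_gt0 prime_gt0. Qed.

Lemma padic_red_val_ltn x n : (val (padic_red x n) < l ^ n)%N.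
Proof. by apply: leq_trans (ltn_ord _) _; rewrite predn_expK. Qed.

Lemma val_inZp_exp n m : val (inZp m : Zmod (l ^ n)) = (m %% l ^ n)%N.
Proof. by rewrite /= predn_expK. Qed.

Lemma val_padic_redM x y n : val (padic_red (x * y) n) =
  ((val (padic_red x n) * val (padic_red y n)) %% l ^ n)%N.
Proof. by rewrite -val_inZp_exp. Qed.

Lemma padic_red_val_mod x n m : (n <= m)%N ->
  val (padic_red x n) = (val (padic_red x m) %% l ^ n)%N.
Proof.
by move=> /subnKC <-; rewrite {1}(padic_red_add _ n (m - n)) val_inZp_exp.
Qed.

Lemma padic_red_sub_val x n : padic_red (x - (val (padic_red x n))%:R) n = 0.
Proof. by apply/padic_red_eq; rewrite padic_natE valZpK. Qed.

(** Division by [l ^ k] costs [k] digits of precision, so the [n]-th residue of the quotient is read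
    off the residue of [x] modulo [l ^ (k + n)]. *)
Lemma padic_red0_dvd x k : padic_red x k = 0 -> exists y, x = (l ^ k)%:R * y.
Proof.
move=> x0; pose d n := (val (padic_red x (k + n)) %/ l ^ k)%N.
have dP n : (inZp (d n) : Zmod (l ^ n)) = inZp (val (inZp (d n.+1) : Zmod (l ^ n.+1))).
  apply: val_inj; rewrite !val_inZp_exp modn_dvdm ?dvdn_exp2l // /d addnS.
  rewrite (padic_red_val_mod x (leqnSn (k + n))).
  by move: (val _) => v; rewrite expnD mulnC -modn_divl modn_mod.
have dk n : (l ^ k %| val (padic_red x (k + n)))%N.
  by rewrite /dvdn -padic_red_val_mod ?leq_addr // x0.
exists (Padic l_prime dP); apply: padicP => n; apply: val_inj.
rewrite val_padic_redM padic_natE !val_inZp_exp modnMml modnMmr.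
by rewrite (padic_red_val_mod x (leq_addl k n)) mulnC divnK.
Qed.

Lemma padic_dvd_red0 x k y : x = (l ^ k)%:R * y -> padic_red x k = 0.
Proof.
move=> ->; apply: val_inj.
by rewrite val_padic_redM padic_natE val_inZp_exp modnn mul0n mod0n.
Qed.

Lemma padic_red0W x m n : (m <= n)%N -> padic_red x n = 0 -> padic_red x m = 0.
Proof.
by move=> mn x0; apply: val_inj; rewrite (padic_red_val_mod _ mn) x0 mod0n.
Qed.

Lemma padic_red0D x y n :
  padic_red x n = 0 -> padic_red y n = 0 -> padic_red (x + y) n = 0.
Proof. by move=> x0 y0; rewrite -[LHS]/(padic_red x n + padic_red y n) x0 y0 addr0. Qed.

Lemma padic_red0N x n : padic_red x n = 0 -> padic_red (- x) n = 0.
Proof. by move=> x0; rewrite -[LHS]/(- padic_red x n) x0 oppr0. Qed.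

Lemma padic_red0M x y n : padic_red x n = 0 -> padic_red (y * x) n = 0.
Proof.
move=> /padic_red0_dvd [z ->]; apply: (@padic_dvd_red0 _ _ (y * z)).
by rewrite mulrCA.
Qed.

Lemma padic_red0_sum (I : Type) (r : seq I) (P : pred I) (F : I -> Zl) n :
  (forall i, P i -> padic_red (F i) n = 0) -> padic_red (\sum_(i <- r | P i) F i) n = 0.
Proof.
by move=> F0; elim/big_ind: _ => // x y; apply: padic_red0D.
Qed.

Lemma padic_red0_int (z : int) n : padic_red (z%:~R : Zl) n = 0 <-> ((l ^ n)%:Z %| z)%Z.
Proof.
have nat0 m : padic_red (m%:R : Zl) n = 0 <-> (l ^ n %| m)%N.
  rewrite padic_natE; split=> [/(congr1 val) /= | /eqP h].
    by rewrite predn_expK => /eqP.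
  by apply: val_inj; rewrite val_inZp_exp.
rewrite dvdzE absz_nat; case: (intP z) => [|m|m].
- by rewrite dvdn0; split.
- by rewrite absz_nat -nat0.
- rewrite abszN absz_nat -nat0 mulrNz; split; last exact: padic_red0N.
  by move/padic_red0N; rewrite opprK.
Qed.

Lemma padic_expMI (k : nat) : injective (fun x => (l ^ k)%:R * x : Zl).
Proof.
move=> x y /= e; apply/eqP; rewrite -subr_eq0; apply/eqP.
have e0 : (l ^ k)%:R * (x - y) = 0 by rewrite mulrBr e subrr.
apply: padicP => n; apply: val_inj; rewrite (padic_red_val_mod _ (leq_addl k n)).
have := congr1 (fun x => val (padic_red x (k + n))) e0.
rewrite val_padic_redM padic_natE val_inZp_exp modnMml => /eqP.
move: (val (padic_red (x - y) _)) => v.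
by rewrite -/(dvdn _ _) expnD dvdn_pmul2l ?expn_gt0 ?prime_gt0 // => /eqP.
Qed.

Lemma padic_red0_expM n k (x : Zl) :
  padic_red ((l ^ n)%:R * x) (n + k) = 0 <-> padic_red x k = 0.
Proof.
split=> [/padic_red0_dvd [y]|/padic_red0_dvd [y ->]].
  by rewrite expnD natrM -mulrA => /padic_expMI; apply: padic_dvd_red0.
by apply: (@padic_dvd_red0 _ _ y); rewrite expnD natrM mulrA.
Qed.

Lemma padic_red1_1 : padic_red (1 : Zl) 1 <> 0.
Proof.
move=> /(congr1 val); rewrite -[padic_red 1 1]/(inZp 1) val_inZp_exp expn1.
by rewrite modn_small ?prime_gt1.
Qed.

Lemma padic_binom_nat m n : padic_binom (m%:R : Zl) n = 'C(m, n)%:R.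
Proof.
apply: (@fact_mulI _ l_prime n).
by rewrite fact_padic_binom natr_ffact -bin_ffact mulnC natrM.
Qed.

(** The falling factorials are congruent to full precision; dividing them by [n!] loses as many
    digits as the valuation of [n!]. *)
Lemma padic_binom_congr (b c : Zl) n k :
    padic_red b (k + logn l n`!) = padic_red c (k + logn l n`!) ->
  padic_red (padic_binom b n) k = padic_red (padic_binom c n) k.
Proof.
move=> bc; set N := logn l n`!; rewrite !(padic_red_add _ k N).
apply/(inZp_eq l_prime)/(@fact_cancel _ l_prime n`!); first exact: fact_gt0.
suff : val (padic_red (n`!%:R * padic_binom b n) (k + N)) =
       val (padic_red (n`!%:R * padic_binom c n) (k + N)).
  by rewrite !val_padic_redM padic_natE val_inZp_exp !modnMml.
rewrite !fact_padic_binom; congr val.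
elim/big_ind2: _ => // [x y x' y'|i _]; first exact: padic_redM.
exact: padic_redB.
Qed.

Lemma padic_binom_cont N L : exists K0, forall K, (K0 <= K)%N ->
  forall b c : Zl, padic_red b K = padic_red c K ->
  forall i, (i < L)%N -> padic_red (padic_binom b i - padic_binom c i) N = 0.
Proof.
exists (N + \max_(i < L) logn l i`!)%N => K K0K b c bc i iL; apply/padic_red_eq.
apply: padic_binom_congr; apply/padic_red_eq; apply: padic_red0W (_ : _ <= K)%N _.
  apply: leq_trans K0K; rewrite leq_add2l.
  exact: leq_bigmax (Ordinal iL).
exact/padic_red_eq.
Qed.

Lemma padic_complete (s : nat -> Zl) : (forall n, padic_red (s n.+1 - s n) n = 0) ->
  exists x, forall n, padic_red (x - s n) n = 0.
Proof.
move=> sP; have h n : padic_red (s n) n = inZp (val (padic_red (s n.+1) n.+1)).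
  by rewrite -padic_compat; apply/esym/padic_red_eq.
by exists (Padic l_prime h) => n; apply/padic_red_eq.
Qed.

(** The map [z |-> w + l * theta z] is an [l]-adic contraction: consecutive iterates [s n] and
    [s n.+1] agree modulo [l ^ n], so they converge coefficientwise. This yields both inverses in
    the [l]-adic integers and Weierstrass preparation. *)
Lemma fps_fixpoint (w : fps Zl) (theta : fps Zl -> fps Zl) :
    (forall f g, theta (f - g) = theta f - theta g) ->
    (forall f n, (forall i, padic_red (fps_coef f i) n = 0) ->
       forall i, padic_red (fps_coef (theta f) i) n = 0) ->
  exists z : fps Zl, z = w + l%:R * theta z.
Proof.
move=> thetaB theta0; pose s n := iter n (fun z => w + l%:R * theta z) w.
have step f n : (forall i, padic_red (fps_coef f i) n = 0) ->
    forall i, padic_red (fps_coef (l%:R * theta f) i) n.+1 = 0.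
  move=> f0 i; have [y yE] := padic_red0_dvd (theta0 _ _ f0 i).
  by apply: (@padic_dvd_red0 _ _ y); rewrite fps_coef_natM yE expnS natrM mulrA.
have sP n i : padic_red (fps_coef (s n.+1) i - fps_coef (s n) i) n = 0.
  rewrite -fps_coefB; elim: n i => [|n IHn] i.
    by apply: val_inj; case: (padic_red _ _) => -[].
  rewrite [s n.+2]/= [in X in _ - X]/= opprD addrACA subrr add0r -mulrBr -thetaB.
  exact: step.
pose z := Fps (fun i => xget 0 [set x | forall n, padic_red (x - fps_coef (s n) i) n = 0]%classic).
have zP n i : padic_red (fps_coef (z - s n) i) n = 0.
  rewrite fps_coefB /=; case: xgetP => [x _ //|] /= h; exfalso.
  by have [x /h] := padic_complete (fun n => sP n i).
exists z; apply: fpsP => i; apply/eqP; rewrite -subr_eq0; apply/eqP.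
apply: padicP => n; apply: (padic_red0W (leqnSn n)).
rewrite -fps_coefB.
have -> : z - (w + l%:R * theta z) = (z - s n.+1) - l%:R * theta (z - s n).
  by rewrite thetaB /=; ring.
by apply: padic_red0D; [|apply: padic_red0N; apply: step => j]; apply: zP.
Qed.

(** Bezout modulo [l] gives [c] with [c x = 1 + l e], and the inverse of [1 + l e] is the solution
    of [z = 1 - l e z], obtained as the constant coefficient of a fixed point. *)
Lemma padic_inv x : padic_red x 1 <> 0 -> exists y, y * x = 1.
Proof.
move=> x0; pose a := val (padic_red x 1).
have aE : a = (a %% l ^ 1)%N := padic_red_val_mod x (leqnn 1).
have al : coprime a l.
  rewrite coprime_sym prime_coprime // /dvdn; apply/negP => /eqP h; apply: x0.
  by apply: val_inj; rewrite -/a aE expn1 h.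
have /padic_red0_dvd [b xab] := padic_red_sub_val x 1; rewrite -/a expn1 in xab.
have a0 : (0 < a)%N.
  case: posnP al => // ->; rewrite /coprime gcd0n => /eqP l1.
  by move: l_prime; rewrite l1.
have /(coprimeP _ a0) [[c d] /= cd] := al.
have {cd} cxE : c%:R * x = 1 + l%:R * (d%:R + c%:R * b).
  have -> : x = a%:R + l%:R * b by rewrite -xab addrC subrK.
  have /(congr1 (fun n => n%:R : Zl)) : (c * a = 1 + d * l)%N.
    by rewrite -cd subnK // ltnW // -subn_gt0 cd.
  rewrite mulrDr natrM natrD natrM => ->.
  ring.
set e := _ + _ * b in cxE.
have [f g|f n f0 i|z zE] := @fps_fixpoint 1 (fun f => Fps (fun i => - e * fps_coef f i)).
- by apply: fpsP => i; rewrite /= mulrBr.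
- exact: padic_red0M.
exists (c%:R * fps_coef z 0%N); rewrite mulrAC cxE.
have := congr1 (fun f => fps_coef f 0%N) zE.
rewrite fps_coefD fps_coef_natM fps_coef1 /= mulNr mulrN => zE0.
by rewrite mulrDl mul1r [X in X + _]zE0 -mulrA subrK.
Qed.

End Padic.

(** * Weierstrass preparation *)

Section Weierstrass.
Variables (l : nat) (l_prime : prime l).
Local Notation Zl := (padic l_prime).
Implicit Types f : fps Zl.

(* Multiplying [f = l a + T^d b] by [z / b], the coefficients of index at least [d] of the
   product equal those of [T^d] iff [z = 1 - l (shift of z a / b)]. *)
Lemma weierstrass_preparation_unit f d :
    (forall i, (i < d)%N -> padic_red (fps_coef f i) 1 = 0) ->
    padic_red (fps_coef f d) 1 <> 0 ->
  exists (g : {poly Zl}) (u : fps Zl),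
    [/\ distinguished g, u \is a GRing.unit & f = fps_of_poly g * u].
Proof.
move=> f0 fd; pose b := fps_shift d f.
have bU : b \is a GRing.unit by apply/fps_unit_coef0/padic_inv.
have /choice [a0 aE] (i : nat) : exists x, (i < d)%N -> fps_coef f i = l%:R * x.
  case: ltnP => id; last by exists 0.
  by have [x] := padic_red0_dvd (f0 i id); rewrite expn1; exists x.
pose a := Fps (fun i => if (i < d)%N then a0 i else 0).
have fE : f = l%:R * a + fps_of_poly 'X^d * b.
  apply: fpsP => i; rewrite fps_coefD fps_coef_natM fps_coefXnM /=.
  by have [/aE -> |di] := ltnP; rewrite ?addr0 // mulr0 add0r subnK.
have [g h|g n g0 i|z zE] :=
  @fps_fixpoint _ l_prime 1 (fun z => - fps_shift d (z * a / b)).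
- rewrite !mulrBl -opprD; congr (- _); exact: fpsP.
- rewrite fps_coefN fps_coef_shift; apply: padic_red0N; rewrite fps_coefM.
  apply: padic_red0_sum => j _.
  rewrite mulrC; apply: padic_red0M; rewrite fps_coefM.
  by apply: padic_red0_sum => k _; rewrite mulrC; apply: padic_red0M.
(* The fixed point equation makes [z] congruent to 1 modulo [l], so [z] is invertible. *)
have z0 : padic_red (fps_coef z 0 - 1) 1 = 0.
  rewrite zE fps_coefD fps_coef1 fps_coef_natM addrC addKr.
  by apply: (@padic_dvd_red0 _ _ _ 1); rewrite expn1.
have zU : z \is a GRing.unit.
  apply/fps_unit_coef0/padic_inv => zz; apply: (@padic_red1_1 _ l_prime).
  have := padic_red0D zz (padic_red0N z0); rewrite opprB addrC subrK.
  exact.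
pose p := z / b * f.
have pE : p = fps_of_poly 'X^d * z + l%:R * (z * a / b).
  rewrite /p fE mulrDr addrC; congr (_ + _); last by ring.
  by rewrite mulrCA divrK.
have pd i : fps_coef p (i + d) = (i == 0%N)%:R.
  rewrite pE fps_coefD fps_coefXnM addnK; case: ltnP => [|_]; first by lia.
  rewrite fps_coef_natM.
  rewrite [in X in X + _]zE fps_coefD fps_coef1 fps_coef_natM.
  rewrite fps_coefN fps_coef_shift mulrN.
  by rewrite subrK.
pose g := \poly_(i < d.+1) fps_coef p i.
have gd : g`_d = 1 by rewrite coef_poly ltnSn -[d in fps_coef p d]add0n pd.
have size_g : size g = d.+1.
  by rewrite size_poly_eq // -[d]add0n pd oner_eq0.
exists g, (b / z); split; last 2 first.
- by rewrite unitrM unitrV bU.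
- have -> : fps_of_poly g = p.
    apply: fpsP => i; rewrite -[LHS]/(g`_i) coef_poly ltnS; case: leqP => // di.
    by rewrite -(subnK (ltnW di)) pd subn_eq0 leqNgt di.
  by rewrite /p mulrAC mulrA divrK // divrr // mul1r.
split; first by apply/eqP; rewrite /lead_coef size_g gd.
move=> i; rewrite size_g /= => id; exists (fps_coef (z * a / b) i).
rewrite coef_poly ltnS (ltnW id) pE fps_coefD fps_coefXnM id add0r.
exact: fps_coef_natM.
Qed.

(** Here [mu] is the largest exponent such that [l ^ mu] divides every coefficient, bounded because
    [f] is nonzero, and [d] is the first index at which the quotient by [l ^ mu] is nonzero modulo
    [l]. *)
Lemma weierstrass_preparation f : f != 0 ->
  exists mu g u, weierstrass_factorization f mu g u.
Proof.
move=> f0.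
have [k [i0 ki0]] : exists k i, padic_red (fps_coef f i) k <> 0.
  apply/not_existsP => h; case/eqP: f0; apply: fpsP => i.
  apply: padicP => k; rewrite fps_coef0; apply: contrapT => ki.
  by apply: (h k); exists i.
pose P k := `[< forall i, padic_red (fps_coef f i) k = 0 >].
have exP : exists k, P k.
  by exists 0%N; apply/asboolP => i; apply: val_inj; case: (padic_red _ _) => -[].
have maxP n : P n -> (n <= k)%N.
  move=> /asboolP Pn; rewrite leqNgt; apply/negP => /ltnW kn.
  by apply: ki0; apply: padic_red0W kn _.
have [mu /asboolP Pmu mumax] := ex_maxnP exP maxP.
have /choice [a aE] (i : nat) : exists x, fps_coef f i = (l ^ mu)%:R * x.
  exact: padic_red0_dvd.
have fE : f = l%:R ^+ mu * Fps a.
  by apply: fpsP => i; rewrite -natrX fps_coef_natM aE.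
have exd : exists d, padic_red (a d) 1 != 0.
  apply: contrapT => h; suff /mumax : P mu.+1 by rewrite ltnn.
  apply/asboolP => i; have /padic_red0_dvd [x xE] : padic_red (a i) 1 = 0.
    by apply/eqP; apply: contrapT => /negP ai; apply: h; exists i.
  by apply: (@padic_dvd_red0 _ _ _ _ x); rewrite aE xE mulrA -natrM -expnD addn1.
have [d /eqP ad dmin] := ex_minnP exd.
have [i id|g [u [gd uU agu]]] := @weierstrass_preparation_unit (Fps a) d _ ad.
  by apply/eqP; apply: contraTT id => /dmin; rewrite -leqNgt.
by exists mu, g, u; split=> //; rewrite fE agu mulrA.
Qed.

(** Modulo [l], the polynomial [g] reduces to a power of [T] and [u] keeps a nonzero constant term.
    Hence the degree of [g] can be read off [f], whichever factorization is chosen. *)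
Lemma weierstrass_factorization_order (f : fps Zl) mu g u :
    weierstrass_factorization f mu g u ->
  (forall i, (i < (size g).-1)%N -> padic_red (fps_coef f i) mu.+1 = 0) /\
  padic_red (fps_coef f (size g).-1) mu.+1 <> 0.
Proof.
case=> -[g_monic glow] uU ->; set d := (size g).-1; rewrite -addn1 -natrX.
have g0 i : (i < d)%N -> padic_red g`_i 1 = 0.
  by case/glow=> c ->; apply: (@padic_dvd_red0 _ _ _ _ c); rewrite expn1.
split=> [i id|].
  rewrite -mulrA fps_coef_natM; apply/padic_red0_expM; rewrite fps_coefM.
  apply: padic_red0_sum => j _; rewrite mulrC; apply: padic_red0M; apply: g0.
  by rewrite (leq_ltn_trans _ id) // -ltnS.
rewrite -mulrA fps_coef_natM => /padic_red0_expM; rewrite fps_coefM big_ord_recr.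
rewrite -[fps_coef _ (@ord_max d)]/(lead_coef g) (eqP g_monic) mul1r subnn => gu0.
have u0 : padic_red (fps_coef u 0) 1 = 0.
  rewrite -[fps_coef u 0](addKr (\sum_(i < d) fps_coef (fps_of_poly g) i * fps_coef u (d - i))).
  apply: padic_red0D gu0; apply: padic_red0N; apply: padic_red0_sum => i _.
  by rewrite mulrC; apply/padic_red0M/g0.
apply: (@padic_red1_1 _ l_prime); have -> : (1 : Zl) = fps_coef (u^-1 * u) 0.
  by rewrite mulVr // fps_coef1.
by rewrite fps_coefM big_ord1; apply: padic_red0M.
Qed.

End Weierstrass.

(** * The voltage Laplacian *)

(** The predicate [I] stands for an ideal, given by its closure properties; the determinant is
    polynomial in the entries, so it respects congruence modulo [I]. *)
Lemma det_congr (R : comNzRingType) (I : R -> Prop) n (A B : 'M[R]_n) :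
    I 0 -> (forall x y, I x -> I y -> I (x + y)) -> (forall a x, I x -> I (a * x)) ->
  (forall i j, I (A i j - B i j)) -> I (\det A - \det B).
Proof.
move=> I0 ID IM IAB; rewrite /determinant -sumrB.
elim/big_ind: _ => // s _; rewrite -mulrBr; apply: (IM).
elim/big_ind2: _; first by rewrite subrr.
  2: by move=> i _; apply: IAB.
move=> x1 x2 y1 y2 Ix Iy.
have -> : x2 * y2 - x1 * y1 = x2 * (y2 - y1) + y1 * (x2 - x1) by ring.
by apply: ID; apply: IM.
Qed.

Lemma coef_XD1_exp (R : nzRingType) n i : (('X + 1) ^+ n : {poly R})`_i = 'C(n, i)%:R.
Proof.
elim: n i => [|n IHn] i; first by rewrite expr0 coef1; case: i.
rewrite exprS mulrDl mul1r coefD coefXM !IHn; case: i => [|i] /=.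
  by rewrite add0r !bin0.
by rewrite binS natrD addrC.
Qed.

Section Laplacian.
Variables (X : multigraph) (gamma : uedge X -> dedge X).

(** The weights of the two orientations are independent, so that one definition covers the
    characteristic matrix, its polynomial approximations and their values at roots of unity. *)
Definition laplacian (R : comNzRingType) (w w' : section_edge gamma -> R) :
    'M[R]_#|vertex X| :=
  diag_mx (\row_i (valency (enum_val i))%:R) -
  \matrix_(i, j)
    (\sum_(s : section_edge gamma | incid (val s) == (enum_val i, enum_val j)) w s +
     \sum_(s : section_edge gamma | incid (val s) == (enum_val j, enum_val i)) w' s).

Lemma laplacian_tr (R : comNzRingType) (w w' : section_edge gamma -> R) :
  (laplacian w w')^T = laplacian w' w.
Proof.
rewrite /laplacian linearB /= tr_diag_mx; congr (_ - _).
by apply/matrixP => i j; rewrite !mxE addrC.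
Qed.

Lemma map_laplacian (R R' : comNzRingType) (phi : {rmorphism R -> R'})
    (w w' : section_edge gamma -> R) :
  map_mx phi (laplacian w w') = laplacian (phi \o w) (phi \o w').
Proof.
apply/matrixP => i j.
by rewrite !mxE rmorphB rmorphMn rmorph_nat rmorphD !rmorph_sum.
Qed.

Lemma det_laplacian_congr (R : comNzRingType) (I : R -> Prop)
    (w w' v v' : section_edge gamma -> R) :
    I 0 -> (forall x y, I x -> I y -> I (x + y)) -> (forall a x, I x -> I (a * x)) ->
    (forall s, I (w s - v s)) -> (forall s, I (w' s - v' s)) ->
  I (\det (laplacian w w') - \det (laplacian v v')).
Proof.
move=> I0 ID IM Iw Iw'; apply: det_congr => // i j; rewrite !mxE.
have arrange (d a b a' b' : R) :
  d - (a + b) - (d - (a' + b')) = -1 * ((a - a') + (b - b')) by ring.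
rewrite arrange -!sumrB.
by apply: (IM); apply: (ID); elim/big_ind: _.
Qed.

(** * Integer polynomials approximating the characteristic series *)

Section Voltage.
Variables (l : nat) (l_prime : prime l).
Local Notation Zl := (padic l_prime).
Variable alpha : section_edge gamma -> Zl.

Definition volt K (s : section_edge gamma) : nat := val (padic_red (alpha s) K).

Definition volt_poly K : {poly int} :=
  \det (laplacian (fun s => 'X^(volt K s)) (fun s => 'X^(l ^ K - volt K s))).

Lemma volt_lt K s : (volt K s < l ^ K)%N.
Proof. exact: padic_red_val_ltn. Qed.

Definition fps_of_int_poly : {poly int} -> fps Zl :=
  @fps_of_poly Zl \o map_poly intr \o comp_poly ('X + 1).

HB.instance Definition _ := GRing.RMorphism.copy fps_of_int_poly
  (@fps_of_poly Zl \o map_poly intr \o comp_poly ('X + 1)).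

Lemma coef_fps_of_int_poly p i :
  fps_coef (fps_of_int_poly p) i = ((p \Po ('X + 1))`_i)%:~R.
Proof. by rewrite -[LHS]/((map_poly intr (p \Po ('X + 1)))`_i) coef_map. Qed.

(** The coefficients of [(1 + T)^b] depend continuously on [b], so for large [K] the two matrices
    agree entrywise modulo the ideal [(l^N, T^L)], and so do their determinants. *)
Lemma char_series_approx N L : exists K0, forall K, (K0 <= K)%N ->
  forall i, (i < L)%N ->
  padic_red (fps_coef (char_series alpha) i -
             ((volt_poly K \Po ('X + 1))`_i)%:~R) N = 0.
Proof.
have [K0 K0P] := padic_binom_cont l_prime N L; exists K0 => K K0K.
have approx (b : Zl) m : padic_red (b - m%:R) K = 0 ->
    forall i, (i < L)%N ->
    padic_red (fps_coef (onePlusT_pow b - fps_of_int_poly 'X^m) i) N = 0.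
  move=> bm i iL; rewrite fps_coefB coef_fps_of_int_poly.
  rewrite rmorphXn /= comp_polyX coef_XD1_exp rmorph_nat -padic_binom_nat.
  by apply: (K0P _ K0K) => //; apply/padic_red_eq.
suff : forall i, (i < L)%N ->
    padic_red (fps_coef (char_series alpha - fps_of_int_poly (volt_poly K)) i) N = 0.
  by move=> h i iL; rewrite -coef_fps_of_int_poly -fps_coefB h.
rewrite /volt_poly -det_map_mx map_laplacian /char_series.
apply: (@det_laplacian_congr _ (fun f => forall i, (i < L)%N -> padic_red (fps_coef f i) N = 0)).
- by move=> i _; rewrite fps_coef0.
- by move=> f g f0 g0 i iL; rewrite fps_coefD padic_red0D ?f0 ?g0.
- move=> g f f0 i iL; rewrite fps_coefM; apply: padic_red0_sum => j _.
  by apply/padic_red0M/f0; rewrite (leq_ltn_trans _ iL) // leq_subr.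
- by move=> s; apply: approx; apply: padic_red_sub_val.
- move=> s; apply: approx; rewrite natrB; last exact/ltnW/volt_lt.
  have -> : - alpha s - ((l ^ K)%:R - (volt K s)%:R) =
      - (alpha s - (volt K s)%:R) - (l ^ K)%:R by ring.
  apply: padic_red0D; apply: padic_red0N; first exact: padic_red_sub_val.
  by apply: (@padic_dvd_red0 _ _ _ _ 1); rewrite mulr1.
Qed.

(* The exponents [a] and [q - a] are exchanged, modulo [q], by multiplication with [q - 1];
   so the substitution [x -> x ^ (q - 1)], that is [x -> 1 / x], transposes the matrix. *)
Lemma volt_poly_inv K : exists r,
  volt_poly K \Po 'X^(l ^ K - 1) - volt_poly K = ('X^(l ^ K) - 1) * r.
Proof.
set q := (l ^ K)%N; have q0 : (0 < q)%N by rewrite expn_gt0 prime_gt0.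
have XX m n : (n <= m)%N -> (q %| m - n)%N ->
    exists r, 'X^m - 'X^n = ('X^q - 1) * r :> {poly int}.
  move=> nm /dvdnP [k kE]; exists ((\sum_(i < k) 'X^q ^+ i) * 'X^n).
  by rewrite mulrA -subrX1 -exprM mulnC -kE mulrBl mul1r -exprD subnK.
rewrite [X in _ - X]/volt_poly -det_tr laplacian_tr /volt_poly.
rewrite -[_ \Po _]/(comp_poly _ _) -det_map_mx map_laplacian.
apply: (@det_laplacian_congr _ (fun p => exists r, p = ('X^q - 1) * r)).
- by exists 0; rewrite mulr0.
- by move=> x y [a ->] [b ->]; exists (a + b); rewrite mulrDr.
- by move=> c x [a ->]; exists (c * a); rewrite mulrCA.
- move=> s /=; rewrite rmorphXn /= comp_polyX -exprM -/q; have := volt_lt K s; rewrite -/q => aq.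
  (* For exponent 0 the exponents to compare are 0 and [q], in the order excluded by [XX]; the
     difference is [1 - X^q]. *)
  have [a0|a0] := posnP (volt K s).
    by exists (- 1); rewrite a0 muln0 subn0 mulrN1 opprB.
  apply: XX; first by nia.
  have -> : ((q - 1) * volt K s - (q - volt K s) = q * (volt K s - 1))%N.
    by nia.
  exact: dvdn_mulr.
- move=> s /=; rewrite rmorphXn /= comp_polyX -exprM -/q; have := volt_lt K s; rewrite -/q => aq.
  apply: XX; first by nia.
  have -> : ((q - 1) * (q - volt K s) - volt K s = q * (q - volt K s - 1))%N by nia.
  exact: dvdn_mulr.
Qed.

End Voltage.
End Laplacian.

(** * Parity of the order *)

Lemma dvdz_sum (d : int) (I : Type) (r : seq I) (P : pred I) (F : I -> int) :
  (forall i, P i -> (d %| F i)%Z) -> (d %| \sum_(i <- r | P i) F i)%Z.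
Proof. by move=> dF; elim/big_ind: _ => // x y; apply: rpredD. Qed.

(* With [h = p(1 + T)], the coefficient of [T^d] in [p((1 + T)^(q - 1))] is
   [(-1)^d] times that of [h] modulo [m]. *)
Lemma dvdz_coef_of_inv (p r : {poly int}) (q m d : nat) :
    p \Po 'X^(q - 1) - p = ('X^q - 1) * r ->
    (0 < q)%N -> odd m -> odd d ->
    (forall j, (0 < j <= d)%N -> (m %| 'C(q, j))%N) ->
    (forall i, (i < d)%N -> (m%:Z %| (p \Po ('X + 1))`_i)%Z) ->
  (m%:Z %| (p \Po ('X + 1))`_d)%Z.
Proof.
move=> pE q0 om od mC mh; set h := p \Po ('X + 1).
have mq : (m %| q)%N by have := mC 1%N; rewrite bin1 (odd_gt0 od); apply.
(* In the variable [T] the substitution is [T -> t = T s], where [s] has constant term [q - 1],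
   congruent to -1 modulo [m]. *)
pose t : {poly int} := ('X + 1) ^+ (q - 1) - 1.
have tE : t = 'X * \poly_(i < size t) t`_i.+1.
  apply/polyP => -[|i]; rewrite coefXM ?coef_poly /=.
    by rewrite coefB coef_XD1_exp bin0 coef1 subrr.
  by case: ltnP => // ti; rewrite nth_default // (leq_trans ti).
set s := \poly_(i < _) _ in tE.
have s0 : s`_0 = q%:Z - 1.
  rewrite coef_poly; case: ltnP => [_|].
    by rewrite coefB coef_XD1_exp bin1 coef1 subr0 natrB // natz.
  (* If [t = 0], its linear coefficient [q - 1] is 0, in agreement with the default coefficient of
     [s]. *)
  rewrite leqn0 size_poly_eq0 => /eqP t0.
  have := congr1 (fun p : {poly int} => p`_1) t0.
  by rewrite coefB coef_XD1_exp bin1 coef1 coef0 subr0 natrB // natz => ->.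
have left : (p \Po 'X^(q - 1)) \Po ('X + 1) = h \Po t.
  rewrite -!comp_polyA; congr (_ \Po _).
  by rewrite comp_polyD comp_polyX comp_polyC /t subrK comp_Xn_poly.
have := congr1 (fun f => (f \Po ('X + 1))`_d) pE.
rewrite comp_polyB comp_polyM left coefB -/h => eqd.
(* The coefficients of [(1 + T)^q - 1] up to index [d] are 0 and binomials divisible by [m]. *)
have dvdR : (m%:Z %| ((('X^q - 1) \Po ('X + 1)) * (r \Po ('X + 1)))`_d)%Z.
  rewrite coefM; apply: dvdz_sum => -[j jd] _ /=; apply: dvdz_mulr.
  rewrite comp_polyB comp_polyC comp_Xn_poly coefB coef_XD1_exp coef1.
  case: j jd => [|j] jd; first by rewrite bin0 subrr dvdz0.
  by rewrite subr0 natz; apply: mC.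
have dvdL : (m%:Z %| (h \Po t)`_d + h`_d)%Z.
  have tX i : (t ^+ i)`_d = if (d < i)%N then 0 else (s ^+ i)`_(d - i).
    by rewrite tE exprMn coefXnM.
  have qd : (m%:Z %| (q%:Z - 1) ^+ d + 1)%Z.
    have -> : (q%:Z - 1) ^+ d + 1 = (q%:Z - 1) ^+ d - (-1) ^+ d.
      by rewrite -signr_odd od expr1 opprK.
    by rewrite subrXX opprK subrK dvdz_mulr.
  rewrite coef_comp_poly.
  have term i : i != d -> (m%:Z %| h`_i * (t ^+ i)`_d)%Z.
    by rewrite tX; case: ltngtP => // [id|di] _; rewrite ?mulr0 ?dvdz0 // dvdz_mulr ?mh.
  have [hd|dh] := leqP (size h) d.
    rewrite (nth_default _ hd) addr0; apply: dvdz_sum => i _; apply: term.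
    by rewrite ltn_eqF // (leq_trans _ hd).
  rewrite (bigD1 (Ordinal dh)) //= addrAC; apply: rpredD; last first.
    by apply: dvdz_sum => i id; apply: term.
  rewrite tX ltnn subnn -[X in _ + X]mulr1 -mulrDr.
  have -> : (s ^+ d)`_0 = (q%:Z - 1) ^+ d by rewrite -!horner_coef0 horner_exp horner_coef0 s0.
  by rewrite dvdz_mull.
(* Both the sum and the difference of the two coefficients are divisible by [m], hence so is
   [2 h_d]; the oddness of [m] removes the factor 2. *)
have : (m%:Z %| h`_d * 2%:Z)%Z.
  have -> : h`_d * 2%:Z = ((h \Po t)`_d + h`_d) - ((h \Po t)`_d - h`_d) by ring.
  by rewrite rpredB // eqd.
by rewrite Gauss_dvdzl // coprimezE /= coprimen2.
Qed.

Section Parity.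
Variables (X : multigraph) (gamma : uedge X -> dedge X).
Variables (l : nat) (l_prime : prime l) (alpha : section_edge gamma -> padic l_prime).

(** For odd [d], the divisibility lemma applied to the approximating polynomial with [m = l ^ N] and
    [q = l ^ K] would force the coefficient of index [d] to vanish modulo [l ^ N]. *)
Lemma char_series_even_order N d : odd l ->
    (forall i, (i < d)%N -> padic_red (fps_coef (char_series alpha) i) N = 0) ->
    padic_red (fps_coef (char_series alpha) d) N <> 0 ->
  ~~ odd d.
Proof.
move=> ol f0 fd; apply/negP => od; apply: fd.
have [K1 K1P] := char_series_approx alpha N d.+1.
have [K2 K2P] := padic_binom_cont l_prime N d.+1.
pose K := maxn K1 K2; have K1K : (K1 <= K)%N := leq_maxl _ _.
have K2K : (K2 <= K)%N := leq_maxr _ _.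
have approx i : (i <= d)%N -> padic_red (fps_coef (char_series alpha) i) N = 0 <->
    ((l ^ N)%:Z %| (volt_poly alpha K \Po ('X + 1))`_i)%Z.
  move=> id; rewrite -(padic_red0_int l_prime); have := K1P _ K1K i id.
  by move=> /padic_red_eq ->.
apply/approx => //; have [r rE] := volt_poly_inv alpha K.
apply: (dvdz_coef_of_inv rE) => //.
- by rewrite expn_gt0 prime_gt0.
- by rewrite oddX ol orbT.
- move=> j /andP[j0 jd]; suff : ((l ^ N)%:Z %| 'C(l ^ K, j)%:Z)%Z by [].
  apply/(padic_red0_int l_prime).
  (* As [l ^ K] is close to 0, continuity makes ['C(l ^ K, j)] congruent to ['C(0, j) = 0] modulo
     [l ^ N]. *)
  have : padic_red ((l ^ K)%:R : padic l_prime) K = padic_red (0%:R : padic l_prime) K.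
    apply/padic_red_eq; rewrite subr0.
    by apply: (@padic_dvd_red0 _ _ _ _ 1); rewrite mulr1.
  move=> /(K2P _ K2K)/(_ j jd); rewrite !padic_binom_nat.
  by rewrite (@bin_small 0) // subr0.
- by move=> i id; apply/approx; [exact: ltnW | exact: f0].
Qed.

End Parity.

(** * Nonvanishing *)

Lemma connect_invariant (T : finType) (A : Type) (e : rel T) (h : T -> A) x y :
  (forall a b, e a b -> h a = h b) -> connect e x y -> h x = h y.
Proof.
move=> he /connectP[p pP ->]; elim: p x pP => //= z p IHp x /andP[/he -> zp].
exact: IHp.
Qed.

(** A nonzero algebraic integer divides a nonzero integer [c], a constant term of an integer
    polynomial vanishing at it. Then [c / l ^ N] is rational and an algebraic integer, hence an
    integer for every [N], which is absurd once [l ^ N] exceeds [c] in absolute value. *)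
Lemma Aint_dvd_exp_eq0 (x : algC) l : (1 < l)%N ->
  (forall N, x / l%:R ^+ N \in Aint) -> x = 0.
Proof.
move=> l1 xN; apply/eqP; apply: contraT => x0.
have xA : x \in Aint by have := xN 0%N; rewrite expr0 divr1.
(* Dividing out the powers of [X] guarantees a nonzero constant term, and [x] remains a root because
   it is nonzero. *)
have [m [q]] := multiplicity_XsubC (minCpoly x) 0.
rewrite minCpoly_eq0 subr0 /= => q0 pE.
have qx : q.[x] = 0.
  have := root_minCpoly x; rewrite /root pE hornerM horner_exp hornerX.
  by rewrite mulf_eq0 expf_eq0 (negPf x0) andbF orbF => /eqP.
have qint i : q`_i \is a Num.int.
  have /polyOverP/(_ (i + m)%N) : minCpoly x \is a polyOver Num.int by [].
  by rewrite pE coefMXn ltnNge leq_addl /= addnK.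
have [c cE] := intrP (qint 0%N).
have c0 : c != 0.
  by move: q0; rewrite /root horner_coef0 cE intr_eq0.
pose y := \sum_(i < (size q).-1) q`_i.+1 * x ^+ i.
have yA : y \in Aint.
  by apply: rpred_sum => i _; rewrite rpredM ?rpredX // Aint_Cint.
have qxy : c%:~R = - (x * y).
  have q_gt0 : (0 < size q)%N.
    by rewrite lt0n size_poly_eq0; apply: contraNneq q0 => ->; exact: root0.
  apply/eqP; rewrite -addr_eq0; apply/eqP; rewrite -[RHS]qx horner_coef.
  rewrite -[in RHS](prednK q_gt0) big_ord_recl cE expr0 mulr1 mulr_sumr; congr (_ + _).
  by apply: eq_bigr => i _; rewrite mulrCA -exprS.
have lN0 N : l%:R ^+ N != 0 :> algC by rewrite expf_neq0 // pnatr_eq0 -lt0n ltnW.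
pose N := `|c|%N; have : (c%:~R / l%:R ^+ N : algC) \is a Num.int.
  apply: Cint_rat_Aint; first by rewrite rpred_div // ?rpredX ?rpred_nat ?rpred_int.
  by rewrite qxy mulNr mulrAC rpredN rpredM.
case/intrP => k kE; have /eqP : c%:~R = (k * l%:Z ^+ N)%:~R :> algC.
  by rewrite rmorphM rmorphXn /= -kE mulfVK.
rewrite eqr_int => /eqP cN; have : (`|c| = `|k| * l ^ N)%N.
  by rewrite {1}cN abszM abszX.
have k0 : k != 0 by apply: contraNneq c0 => k0; rewrite cN k0 mul0r.
have : (`|c| < l ^ N)%N by apply: ltn_expl.
have : (0 < `|k|)%N by rewrite absz_gt0.
by move=> ? ? ?; nia.
Qed.

Section Nonvanishing.
Variables (X : multigraph) (gamma : uedge X -> dedge X).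
Hypothesis gammaK : cancel gamma (@uedge_pi X).

(** Inversion exchanges the image of the section with its complement. *)
Lemma sum_dedge (R : zmodType) (h : dedge X -> R) :
  \sum_e h e = \sum_(s : section_edge gamma) (h (val s) + h (einv (val s))).
Proof.
rewrite big_split /= (bigID (mem (section_image gamma))) /= big_sub; congr (_ + _).
rewrite -(big_sub (mem (section_image gamma)) (fun e => h (einv e))) /=.
rewrite (reindex_inj (inv_inj (@einvK X))); apply: eq_bigl => e.
by rewrite (section_dichotomy gammaK) negbK.
Qed.

Lemma sum_valency (R : nzRingType) (g : vertex X -> R) :
  \sum_x (valency x)%:R * g x =
  \sum_(s : section_edge gamma) (g (origin (val s)) + g (target (val s))).
Proof.
transitivity (\sum_e g (origin e)).
  rewrite (partition_big (@origin X) predT) //=; apply: eq_bigr => x _.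
  rewrite /valency -sum1_card natr_sum mulr_suml; apply: eq_big => [e|e].
    by rewrite inE.
  by rewrite inE => /eqP ->; rewrite mul1r.
by rewrite sum_dedge; apply: eq_bigr => s _; rewrite {2}/origin incid_einv.
Qed.

Lemma sum_incid (R : zmodType) (g : section_edge gamma -> vertex X -> vertex X -> R) :
  \sum_x \sum_y \sum_(s : section_edge gamma | incid (val s) == (x, y)) g s x y =
  \sum_s g s (origin (val s)) (target (val s)).
Proof.
rewrite pair_bigA /= [RHS](partition_big (fun s => incid (val s)) predT) //=.
apply: eq_bigr => -[x y] _; apply: eq_bigr => s /eqP sxy.
by rewrite /origin /target sxy.
Qed.

(** This edgewise expression of the bilinear form becomes a sum of squares when [g] is the conjugate
    of [f] and the weights have absolute value 1. *)
Lemma laplacian_form (R : comNzRingType) (w w' : section_edge gamma -> R)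
    (f g : vertex X -> R) :
  \sum_i \sum_j f (enum_val i) * laplacian w w' i j * g (enum_val j) =
  \sum_s (f (origin (val s)) * g (origin (val s)) +
          f (target (val s)) * g (target (val s)) -
          w s * f (origin (val s)) * g (target (val s)) -
          w' s * f (target (val s)) * g (origin (val s))).
Proof.
transitivity (\sum_x \sum_y f x * ((valency x)%:R *+ (x == y) -
   (\sum_(s : section_edge gamma | incid (val s) == (x, y)) w s +
    \sum_(s : section_edge gamma | incid (val s) == (y, x)) w' s)) * g y).
  rewrite (big_enum_val (A := vertex X)); apply: eq_bigr => i _.
  rewrite (big_enum_val (A := vertex X)); apply: eq_bigr => j _.
  by rewrite !mxE (inj_eq enum_val_inj).
transitivity (\sum_x (valency x)%:R * (f x * g x) -
    \sum_x \sum_y \sum_(s : section_edge gamma | incid (val s) == (x, y)) (w s * f x * g y) -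
    \sum_y \sum_x \sum_(s : section_edge gamma | incid (val s) == (y, x)) (w' s * f x * g y)).
  rewrite [X in _ - _ - X]exchange_big -!sumrB; apply: eq_bigr => x _.
  transitivity (\sum_y (((valency x)%:R * (f x * g y)) *+ (x == y) -
     \sum_(s : section_edge gamma | incid (val s) == (x, y)) (w s * f x * g y) -
     \sum_(s : section_edge gamma | incid (val s) == (y, x)) (w' s * f x * g y))).
    have sumE (P : pred (section_edge gamma)) (u : section_edge gamma -> R) y :
        \sum_(s | P s) u s * f x * g y = (\sum_(s | P s) u s) * f x * g y.
      by rewrite !mulr_suml.
    apply: eq_bigr => y _; rewrite !sumE.
    by case: (x == y); rewrite ?mulr1n ?mulr0n; ring.
  rewrite !sumrB; congr (_ - _ - _).
  rewrite (bigD1 x) //= eqxx mulr1n big1 ?addr0 // => y yx.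
  by rewrite eq_sym (negPf yx).
rewrite sum_valency (sum_incid (fun s x y => w s * f x * g y)).
rewrite (sum_incid (fun s y x => w' s * f x * g y)) -!sumrB.
by [].
Qed.

Lemma laplacian_ker (w : section_edge gamma -> algC) (f : vertex X -> algC) :
    (forall s, `|w s| = 1) ->
    (forall j, \sum_i f (enum_val i) * laplacian w (fun s => (w s)^-1) i j = 0) ->
  forall s, f (target (val s)) = w s * f (origin (val s)).
Proof.
move=> w1 f0 s; set F := fun s => `|f (target (val s)) - w s * f (origin (val s))| ^+ 2.
have F0 : \sum_s F s = 0.
  transitivity (\sum_i \sum_j f (enum_val i) *
      laplacian w (fun s => (w s)^-1) i j * (f (enum_val j))^*).
    rewrite (laplacian_form w _ f (fun x => (f x)^*)); apply: eq_bigr => {}s _.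
    have wV : (w s)^* = (w s)^-1 by rewrite invC_norm w1 expr1n invr1 mul1r.
    rewrite /F normCK rmorphB rmorphM /= wV; set a := f _; set b := f _.
    have ws : w s / w s = 1 by rewrite divff // -normr_eq0 w1 oner_eq0.
    have -> : (a - w s * b) * (a^* - (w s)^-1 * b^*) =
      a * a^* + (w s / w s) * (b * b^*) - w s * b * a^* - (w s)^-1 * a * b^* by ring.
    by rewrite ws mul1r [a * _ + _]addrC.
  by rewrite exchange_big big1 //= => j _; rewrite -mulr_suml f0 mul0r.
have /eqP : F s = 0.
  by apply: (psumr_eq0P _ F0) => // s' _; rewrite exprn_ge0 ?normr_ge0.
by rewrite expf_eq0 /= normr_eq0 subr_eq0 => /eqP.
Qed.

Variables (l : nat) (l_prime : prime l) (alpha : section_edge gamma -> padic l_prime).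

Lemma det_laplacian_root_neq0 (z : algC) : l.-primitive_root z ->
    connected (derived gammaK (fun s => padic_red (alpha s) 1)) ->
  \det (laplacian (fun s => z ^+ volt alpha 1 s) (fun s => (z ^+ volt alpha 1 s)^-1)) != 0.
Proof.
move=> zP conn; apply/det0P => -[v v0 vM]; case/negP: v0; apply/eqP.
have z1 : `|z| = 1.
  apply/eqP; rewrite -(pexpr_eq1 (prime_gt0 l_prime)) //.
  by rewrite -normrX (prim_expr_order zP) normr1.
have zN0 : z != 0 by rewrite -normr_eq0 z1 oner_eq0.
pose f x := v 0 (enum_rank x).
have fP : forall s, f (target (val s)) = z ^+ volt alpha 1 s * f (origin (val s)).
  apply: laplacian_ker => [s|j]; first by rewrite normrX z1 expr1n.
  have /matrixP/(_ 0 j) := vM; rewrite !mxE => vj; rewrite -[RHS]vj.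
  by apply: eq_bigr => i _; rewrite /f enum_valK.
pose E (a : Zmod (l ^ 1)) := z ^+ val a.
have zmod n : z ^+ (n %% (l ^ 1).-1.+1) = z ^+ n.
  by rewrite predn_expK // expn1 (prim_expr_mod zP).
have ED a b : E (a + b) = E a * E b by rewrite /E /= zmod exprD.
have E0 : E 0 = 1 by [].
(* The relation passes from the section to all directed edges by antisymmetry of the extended
   voltage. *)
have fe e : f (target e) = E (extend (fun s => padic_red (alpha s) 1) e) * f (origin e).
  have fS e' : e' \in section_image gamma ->
      f (target e') = E (extend (fun s => padic_red (alpha s) 1) e') * f (origin e').
    by move=> eS; rewrite /extend insubT /= -[e' in LHS]/(val (Sub e' eS : section_edge gamma)) fP.
  have [/fS //|] := boolP (e \in section_image gamma).
  rewrite -(section_dichotomy gammaK) => /fS; rewrite /target /origin incid_einv /=.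
  rewrite (extend_einv gammaK); set b := extend _ _ => ->.
  by rewrite mulrA -ED addrN E0 mul1r.
have EN0 b : E b != 0 by rewrite expf_neq0.
have inv p r : f p.1 / E p.2 = f r.1 / E r.2 :> algC.
  apply: (connect_invariant (h := fun p : vertex X * Zmod (l ^ 1) => f p.1 / E p.2) _ (conn p r)).
  move=> a b /existsP[[e g] /eqP]; rewrite /= /derived_incid => -[<- <-] /=.
  rewrite ED fe.
  by rewrite [in RHS](mulrC (E g)) -mulf_div mulfV // mul1r.
apply/rowP => i; rewrite mxE -[i]enum_valK -/(f _).
(* Comparing two points of the same fibre gives [f x = f x / z], and [z] differs from 1. *)
set x := enum_val i; have := inv (x, 0) (x, inZp 1).
rewrite /= E0 divr1 /E /= zmod expr1 => /eqP; rewrite -subr_eq0 -{1}[f x]mulr1 -mulrBr.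
rewrite mulf_eq0 subr_eq0 => /orP[/eqP //|]; rewrite eq_sym invr_eq1 -[z]expr1 -(expr0 z).
by rewrite (eq_prim_root_expr zP) mod0n modn_small ?prime_gt1.
Qed.

(** Expand [F(z)] in powers of [z - 1], with coefficients those of [F(1 + T)]. If the series is
    zero, those of index below [l * N] are divisible by [l ^ N]; in the other terms the power of
    [z - 1] is, since [l] divides [(z - 1) ^ l]. *)
Lemma char_series_neq0 :
    connected (derived gammaK (fun s => padic_red (alpha s) 1)) ->
  char_series alpha != 0.
Proof.
have [z zP] := C_prim_root_exists (prime_gt0 l_prime).
move/(det_laplacian_root_neq0 zP); apply: contraNneq => f0; set delta := \det _.
have zA := Aint_prim_root zP.
(* Expand [(1 + (z - 1)) ^ l = z ^ l = 1]: the inner binomial coefficients are divisible by the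
   prime [l]. *)
have [h hA zl] : exists2 h, h \in Aint & (z - 1) ^+ l = l%:R * h.
  have := exprD1n (z - 1) l; rewrite subrK (prim_expr_order zP) big_ord_recr /= binn mulr1n.
  rewrite -(prednK (prime_gt0 l_prime)) big_ord_recl /= (prednK (prime_gt0 l_prime)).
  rewrite expr0 bin0 mulr1n -addrA => /eqP; rewrite -subr_eq0 opprD addrA subrr add0r.
  rewrite oppr_eq0 addrC addr_eq0 => /eqP ->.
  exists (- \sum_(i < l.-1) (z - 1) ^+ i.+1 * ('C(l, i.+1) %/ l)%:R).
    by rewrite rpredN rpred_sum // => i _; rewrite rpredM ?rpredX ?rpredB ?rpred_nat ?Aint1.
  rewrite mulrN mulr_sumr; congr (- _); apply: eq_bigr => i _.
  rewrite mulrCA -natrM mulnC divnK ?mulr_natr // prime_dvd_bin //=.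
  by rewrite -ltn_predRL.
apply/eqP/(Aint_dvd_exp_eq0 (prime_gt1 l_prime)) => N.
have [K0 K0P] := char_series_approx alpha N (l * N).
(* With [K] positive, residues modulo [l ^ K] determine those modulo [l], and [z ^ (l ^ K) = 1]. *)
pose K := (maxn K0 1); have K0K : (K0 <= K)%N := leq_maxl _ _.
have K1 : (0 < K)%N by rewrite leq_max orbT.
pose phi := horner_eval z \o map_poly (intr : int -> algC).
have z0 : z != 0.
  apply: contra_eq_neq (prim_expr_order zP) => ->.
  by rewrite expr0n gtn_eqF ?prime_gt0 // eq_sym oner_eq0.
have zl0 n : (l %| n)%N -> z ^+ n = 1.
  by case/dvdnP => m ->; rewrite mulnC exprM (prim_expr_order zP) expr1n.
have zvolt s : z ^+ volt alpha 1 s = z ^+ volt alpha K s.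
  by rewrite {1}/volt (padic_red_val_mod _ K1) expn1 (prim_expr_mod zP).
have deltaE : delta = phi (volt_poly alpha K).
  rewrite /phi /volt_poly -det_map_mx map_laplacian /delta.
  congr (\det (laplacian _ _)); apply: funext => s /=.
    by rewrite map_polyXn /horner_eval hornerXn zvolt.
  rewrite map_polyXn /horner_eval hornerXn zvolt.
  have zn0 : z ^+ volt alpha K s != 0 by rewrite expf_neq0.
  apply: (mulIf zn0); rewrite mulVf // -exprD subnK ?zl0 //.
    by rewrite -{1}[l]expn1 dvdn_exp2l.
  exact/ltnW/volt_lt.
pose G := volt_poly alpha K \Po ('X + 1).
have -> : delta = \sum_(i < size G) (G`_i)%:~R * (z - 1) ^+ i.
  transitivity (map_poly (intr : int -> algC) G).[z - 1].
    rewrite deltaE /phi /= map_comp_poly horner_comp rmorphD rmorph1 /= map_polyX.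
    by rewrite hornerD hornerX hornerC subrK.
  rewrite (horner_coef_wide _ (size_poly _ _)); apply: eq_bigr => i _.
  by rewrite coef_map.
have lN0 : l%:R ^+ N != 0 :> algC.
  by rewrite expf_neq0 // pnatr_eq0 -lt0n prime_gt0.
rewrite mulr_suml rpred_sum // => i _.
have [iL|Li] := ltnP i (l * N).
  have /dvdzP[c ->] : ((l ^ N)%:Z %| G`_i)%Z.
    apply/(padic_red0_int l_prime); have /padic_red_eq <- := K0P K K0K i iL.
    by rewrite f0 fps_coef0.
  rewrite rmorphM /= -[((l ^ N)%:Z)%:~R]/((l ^ N)%:R) natrX mulrAC mulfK //.
  by rewrite rpredM ?rpredX ?rpredB ?Aint1 ?Aint_int.
rewrite -(subnK Li) exprD exprM zl exprMn [_ ^+ N * _]mulrC !mulrA mulfK //.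
by rewrite !rpredM ?rpredX ?rpredB ?Aint1 ?Aint_int.
Qed.

End Nonvanishing.

Theorem theorem2p18 (X : multigraph) (l : nat) (l_prime : prime l)
    (gamma : uedge X -> dedge X) (gammaK : cancel gamma (@uedge_pi X))
    (alpha : section_edge gamma -> padic l_prime) :
  euler_char X != 0 ->
  odd l ->
  (forall n : nat,
     connected (derived gammaK (fun s => padic_red (alpha s) n))) ->
  odd `|lambda_voltage alpha|%N.
Proof.
move=> _ l_odd conn; rewrite /lambda_voltage /lambda_invariant.
(* The default value of [xget] is excluded by the existence of a factorization. *)
case: xgetP => [lam -> [mu [g [u [fE ->]]]]|/= h]; last first.
  have [mu [g [u fE]]] := weierstrass_preparation (char_series_neq0 (conn 1%N)).
  by exfalso; apply: (h ((size g).-1%:Z - 1)); exists mu, g, u.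
have [flow fd] := weierstrass_factorization_order fE.
have := char_series_even_order l_odd flow fd.
(* For degree 0 the invariant is -1, of odd absolute value; otherwise the even degree is [d.+1] and
   the invariant is [d]. *)
case: (_.-1) => [//|d] d_odd.
by rewrite -[d.+1]addn1 PoszD addrK absz_nat -[odd d]negbK.
Qed.
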